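(* Let $(X,(\varphi_t)_{t\in\mathbb{R}})$ be any flow. Then $(X,(\varphi_t)_{t\in\mathbb{R}})$ can be embedded in the translation flow $(L(\mathbb{R})^{\mathbb{N}},(T_t)_{t\in\mathbb{R}})$; that is, there exists a map $\phi:X\to L(\mathbb{R})^{\mathbb{N}}$ which is a homeomorphism of $X$ onto its image $\phi(X)$ and satisfies $\phi(\varphi_t x)=T_t\phi(x)$ for all $x\in X$ and $t\in\mathbb{R}$.
   Context: A flow is a pair $(X,(\varphi_t)_{t\in\mathbb{R}})$, where $X$ is a compact metric space and $\mathbb{R}\times X\to X$, $(t,x)\mapsto \varphi_t x$, is a continuous action of the additive group $\mathbb{R}$ (so $\varphi_0=\mathrm{id}_X$ and $\varphi_{s+t}=\varphi_s\circ\varphi_t$ for all $s,t\in\mathbb{R}$). $C(\mathbb{R})$ denotes the space of continuous functions $f:\mathbb{R}\to[0,1]$ with the topology of uniform convergence on compact subsets of $\mathbb{R}$, given by the distance $\sum_{n=1}^\infty 2^{-n}\max_{|t|\le n}|f(t)-g(t)|$ for $f,g\in C(\mathbb{R})$. $L(\mathbb{R})\subset C(\mathbb{R})$ denotes the set of all functions $f:\mathbb{R}\to[0,1]$ with $|f(s)-f(t)|\le|s-t|$ for all $s,t\in\mathbb{R}$, with the induced distance. The space $L(\mathbb{R})^{\mathbb{N}}$ (sequences $(f_i)_{i\in\mathbb{N}}$ with $f_i\in L(\mathbb{R})$) carries the product topology. The group $\mathbb{R}$ acts on $L(\mathbb{R})^{\mathbb{N}}$ by translation in every coordinate: $T_s\big((f_i)_{i\in\mathbb{N}}\big)=\big(f_i(\cdot+s)\big)_{i\in\mathbb{N}}$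 for $s\in\mathbb{R}$. *)

(* Defs.v *)
From HB Require Import structures.
From mathcomp Require Import all_boot all_order all_algebra.
From mathcomp Require Import all_classical all_reals all_analysis.

Set Implicit Arguments.
Unset Strict Implicit.
Unset Printing Implicit Defensive.

Import Order.TTheory GRing.Theory Num.Theory.
Import numFieldNormedType.Exports.

Local Open Scope classical_set_scope.
Local Open Scope ring_scope.

Record is_flow (R : realType) (X : metricType R) (phi : R -> X -> X) : Prop :=
  IsFlow {
    flow_compact : compact [set: X] ;
    flow_continuous : continuous (fun p : R * X => phi p.1 p.2) ;
    flow0 : phi 0 = id ;
    flowD : forall s t : R, phi (s + t) = phi s \o phi t
  }.

(* [{family compact, R -> R}] carries the topology of uniform convergence on
   compact sets; on [CR] this is the topology of the distance
   \sum_(n >= 1) 2^-n max_(|t| <= n) |f t - g t|. As types, [CR] and [LR] are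
   given the induced (subset) topology by the library. *)
Definition CR (R : realType) : set {family compact, R -> R} :=
  [set f | continuous (f : R -> R) /\ forall t : R, 0 <= f t <= 1].

Definition LR (R : realType) : set {family compact, R -> R} :=
  [set f | (forall t : R, 0 <= f t <= 1) /\
           (forall s t : R, `|f s - f t| <= `|s - t|)].

Lemma LR_subset_CR (R : realType) : @LR R `<=` @CR R.
Proof.
move=> f [f01 fL]; split=> // t; apply/cvgrPdist_le => e e0.
near=> s; apply: le_trans (fL t s) _.
by near: s; exact: cvgr_dist_le.
Unshelve. all: by end_near. Qed.

Definition LRN (R : realType) : topologicalType := {ptws nat -> @LR R}.

Lemma LR_shift (R : realType) (s : R) (f : @LR R) :
  @LR R (fun t : R => set_val f (t + s)).
Proof.
have [f01 fL] := set_valP f; split=> [t|t u]; first exact: f01.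
by apply: le_trans (fL _ _) _; rewrite opprD addrACA subrr addr0.
Qed.

Definition shiftL (R : realType) (s : R) (f : @LR R) : @LR R :=
  SigSub (mem_set (LR_shift s f)).

Definition translation (R : realType) (s : R) (f : LRN R) : LRN R :=
  fun i => shiftL s (f i).

Definition homeomorphism (X Y : topologicalType) (f : X -> Y) : Prop :=
  continuous f /\
  exists g : Y -> X, [/\ continuous g, cancel f g & cancel g f].

Definition corestriction (X Y : topologicalType) (f : X -> Y) (x : X) :
  range f := SigSub (mem_set (imageT f x)).

Definition homeomorphism_onto_image (X Y : topologicalType) (f : X -> Y) :
  Prop := homeomorphism (corestriction f).

(* Main.v *)
Require Import Defs.
From HB Require Import structures.
From mathcomp Require Import all_boot all_order all_algebra.
From mathcomp Require Import all_classical all_reals all_analysis.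
From mathcomp Require Import lra.

Import Order.TTheory GRing.Theory Num.Theory.
Import numFieldNormedType.Exports.

(** Why the theorem holds.  A continuous nonnegative function [f] of time can be
    regularized into a 1-Lipschitz function with values in [[0, 1]], its
    truncated Lipschitz envelope
    [[
      envelope f t = inf_u min(1, f u + |u - t|).
    ]]
    Fix a dense sequence [a i] of the compact metric space [X], and let the
    [i]-th coordinate of the image of [x] be the envelope of the function
    [u |-> d(a i, varphi u x)] that records the distance from the orbit of [x]
    to [a i].  Four facts make this map an equivariant embedding.

    - Equivariance: the envelope is built from [f] and from differences of times
      only, hence commutes with translations ([envelope_shift]).
    - Continuity: because of the truncation at 1, the value of the envelope at
      [t] depends on [f] on [[t - 1, t + 1]] only, and depends on it in a
      1-Lipschitz way for the sup norm ([envelope_local]).  On a compact set of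
      times, the envelope is thus controlled by the orbit over a slightly larger
      compact interval ([continuous_envelope_family]).
    - Injectivity: suppose that [x] and [y] have the same image, and take [a i]
      very close to [x].  The [i]-th coordinate of [x] at time 0 is tiny, hence
      so is that of [y]: some [varphi u y] with tiny [u] is close to [a i], and
      so to [x].  In the limit [y = x] ([orbit_envelope_separates]).
    - An injective continuous map from a compact space to a Hausdorff space is a
      homeomorphism onto its image ([compact_embedding], [LRN_hausdorff]). *)

Local Open Scope classical_set_scope.
Local Open Scope ring_scope.

(** * Truncated Lipschitz envelopes *)

Section lipschitz_envelope.
Context {R : realType}.
Implicit Types (f g : R -> R) (s t u : R).

Definition envelope f t : R :=
  inf (range (fun u => Num.min 1 (f u + `|u - t|))).

Lemma has_inf_envelope f t : (forall u, 0 <= f u) ->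
  has_inf (range (fun u => Num.min 1 (f u + `|u - t|))).
Proof.
move=> f0; split; first by exists (Num.min 1 (f 0 + `|0 - t|)); exists 0.
by exists 0 => _ [u _ <-]; rewrite le_min ler01 addr_ge0.
Qed.

Lemma envelope_le f t u : (forall v, 0 <= f v) ->
  envelope f t <= Num.min 1 (f u + `|u - t|).
Proof.
by move=> f0; apply: ge_inf; [case: (has_inf_envelope f t f0)|exists u].
Qed.

Lemma le_envelope f t c : (forall u, c <= Num.min 1 (f u + `|u - t|)) ->
  c <= envelope f t.
Proof.
move=> cf; apply: lb_le_inf => [|_ [u _ <-]//].
by exists (Num.min 1 (f 0 + `|0 - t|)); exists 0.
Qed.

Lemma envelope_ge0_le1 f t : (forall u, 0 <= f u) -> 0 <= envelope f t <= 1.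
Proof.
move=> f0; apply/andP; split.
  by apply: le_envelope => u; rewrite le_min ler01 addr_ge0.
by apply: le_trans (envelope_le f t 0 f0) _; rewrite ge_min lexx.
Qed.

Lemma envelope_ltP f t e : (forall u, 0 <= f u) -> e <= 1 ->
  envelope f t < e -> exists u, f u + `|u - t| < e.
Proof.
move=> f0 e1 /(inf_lt (has_inf_envelope f t f0).1)[_ [u _ <-]].
by rewrite gt_min ltNge e1 /=; exists u.
Qed.

(** Each function [t |-> f u + |u - t|] is 1-Lipschitz, and this property is
    inherited by truncations and infima. *)
Lemma envelope_lipschitz f s t : (forall u, 0 <= f u) ->
  `|envelope f s - envelope f t| <= `|s - t|.
Proof.
move=> f0.
have half a b : envelope f a <= envelope f b + `|a - b|.
  rewrite -lerBlDr; apply: le_envelope => u; rewrite lerBlDr.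
  apply: le_trans (envelope_le f a u f0) _.
  rewrite addr_minl le_min !ge_min lerDl normr_ge0 /=; apply/orP; right.
  by rewrite -addrA lerD2l (distrC a b) ler_distD.
have := half s t; have := half t s; rewrite (distrC t s) ler_norml; lra.
Qed.

(** Substituting [u + s] for [u] preserves the range over which the infimum is
    taken. *)
Lemma envelope_shift f s t :
  envelope (fun u => f (u + s)) t = envelope f (t + s).
Proof.
rewrite /envelope; congr inf; apply/seteqP; split => _ [u _ <-].
  by exists (u + s) => //; rewrite [in LHS]opprD addrACA subrr addr0.
by exists (u - s) => //; rewrite subrK opprD addrA addrAC.
Qed.

(** A time [u] at distance more than 1 from [t] contributes the value 1 to the
    infimum, whatever the function is; the other times contribute values that
    differ by at most [e]. *)
Lemma envelope_local f g t e : (forall u, 0 <= f u) -> (forall u, 0 <= g u) ->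
  (forall u, `|u - t| <= 1 -> `|f u - g u| <= e) ->
  `|envelope f t - envelope g t| <= e.
Proof.
move=> f0 g0 fge.
have e0 : 0 <= e by rewrite (le_trans _ (fge t _))// subrr normr0 ler01.
have half (a b : R -> R) : (forall u, 0 <= a u) -> (forall u, 0 <= b u) ->
    (forall u, `|u - t| <= 1 -> a u <= b u + e) ->
    envelope a t <= envelope b t + e.
  move=> a0 b0 ab; rewrite -lerBlDr; apply: le_envelope => u; rewrite lerBlDr.
  apply: le_trans (envelope_le a t u a0) _.
  rewrite addr_minl le_min !ge_min lerDl e0 /=.
  have [ut|ut] := leP `|u - t| 1.
    by rewrite addrAC lerD2r ab// orbT.
  by apply/orP; left; have := b0 u; lra.
have h1 : envelope f t <= envelope g t + e.
  by apply: half => // u /fge; rewrite ler_norml; lra.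
have h2 : envelope g t <= envelope f t + e.
  by apply: half => // u /fge; rewrite ler_norml; lra.
by rewrite ler_norml; lra.
Qed.

End lipschitz_envelope.

(** * Compact metric spaces *)

Section metric.
Context {R : realType} {X : metricType R}.

Lemma mdist_continuous (a : X) : continuous (mdist a : X -> R).
Proof.
move=> x; apply/cvgrPdist_lt => e e0.
apply: filterS (nbhsx_ballx x e e0) => y; rewrite ballEmdist /= => xy.
have := metric_triangle a x y; have := metric_triangle a y x.
rewrite (metric_sym y x) ltr_norml; lra.
Qed.

(** The finite subsets of [X], ordered by inclusion, define a filter; each point
    has a neighbourhood that lies within [e] of every finite set containing the
    point, so compactness gives one finite set that serves all points. *)
Lemma compact_totally_bounded (e : R) : 0 < e -> compact [set: X] ->
  exists s : seq X, forall x, exists2 a, a \in s & mdist a x < e.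
Proof.
move=> e0 /compact_near_coveringP cX.
pose F : set_system (seq X) :=
  filter_from [set: seq X] (fun s => [set r | {subset s <= r}]).
have FF : Filter F.
  apply: filter_from_filter; first by exists [::].
  move=> s r _ _; exists (s ++ r) => // q sq.
  by split=> a ar; apply: sq; rewrite mem_cat ar ?orbT.
have [x _|s _ sP] := cX _ F (fun s x => exists2 a, a \in s & mdist a x < e) FF.
  exists ([set y | mdist x y < e], [set r | {subset [:: x] <= r}]).
    split => /=; last by exists [:: x].
    by rewrite -ballEmdist; exact: nbhsx_ballx.
  by move=> [y r] /= [xy xr]; exists x => //; apply: xr; rewrite inE.
by exists s => x; apply: (sP s).
Qed.

(** The terms of the finite nets of mesh [1 / n.+1], for all [n], are enumerated
    by coding pairs (net, position in the net) as natural numbers. *)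
Lemma compact_dense_sequence (x0 : X) : compact [set: X] ->
  exists a : nat -> X, forall x (e : R), 0 < e -> exists i, mdist (a i) x < e.
Proof.
move=> cX.
have /choice[s sP] n : exists s : seq X,
    forall x, exists2 a, a \in s & mdist a x < n.+1%:R^-1 :> R.
  exact: compact_totally_bounded.
exists (fun i => if unpickle i is Some (n, k) then nth x0 (s n) k else x0).
move=> x e e0; have [n] := ltr_add_invr e0; rewrite add0r => ne.
have [a /(nthP x0)[k _ <-] ax] := sP n x.
by exists (pickle (n, k)); rewrite pickleK; exact: lt_trans ne.
Qed.

End metric.

(** * Embeddings of compact spaces *)

Section topology.

(** If all neighbourhoods of [y] and [z] meet, then so do all neighbourhoods of
    [h i y] and [h i z], which are therefore the same real number. *)
Lemma separating_hausdorff (R : realType) (Y : topologicalType)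
    (I : Type) (h : I -> Y -> R) :
  (forall i, continuous (h i)) ->
  (forall y z, (forall i, h i y = h i z) -> y = z) -> hausdorff_space Y.
Proof.
move=> hc hsep y z yz; apply: hsep => i; apply: Rhausdorff => A B yA zB.
by have [w [Aw Bw]] := yz _ _ (hc i y _ yA) (hc i z _ zB); exists (h i w).
Qed.

(** The inverse is continuous because the map is closed: a closed subset of the
    compact domain is compact, so its image is compact, hence closed. *)
Lemma compact_embedding (X Y : topologicalType) (f : X -> Y) :
  compact [set: X] -> hausdorff_space Y -> continuous f -> injective f ->
  homeomorphism_onto_image f.
Proof.
move=> cX hY cf injf; split; first exact: continuous_comp_initial.
have /choice[g gP] (y : range f) : exists x, f x = set_val y.
  by have [x _ fx] := set_valP y; exists x.
have gK : cancel g (corestriction f).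
  move=> y; apply: val_inj; exact: gP.
have fK : cancel (corestriction f) g.
  by move=> x; apply: injf; exact: gP.
exists g; split => //; apply/continuous_closedP => C cC.
have -> : g @^-1` C = set_val @^-1` (f @` C).
  apply/seteqP; split => y /=; first by exists (g y).
  by move=> [x Cx fxy]; rewrite -(injf x (g y))// gP.
apply: (closed_comp (fun _ _ => @initial_continuous _ _ set_val _)).
apply: compact_closed => //; apply: continuous_compact.
  exact: continuous_subspaceT.
exact: subclosed_compact cC cX _.
Qed.

End topology.

(** * The topology of uniform convergence on compact sets *)

Section LRN_topology.
Context {R : realType}.

(** The evaluations [f |-> f i t] are continuous and separate points. *)
Lemma LRN_hausdorff : hausdorff_space (LRN R).
Proof.
apply: (@separating_hausdorff R _ (nat * R)%type
  (fun it (f : LRN R) => (set_val (f it.1) : R -> R) it.2)).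
  move=> [i t] f /=.
  have /pointwise_cvgP/(_ t) :
      {ptws, nbhs (set_val (f i) : {family compact, R -> R}) --> set_val (f i)}.
    exact: pointwise_cvg_compact_family.
  have fi : (fun g : LRN R => set_val (g i)) @ f --> set_val (f i).
    apply: (@continuous_comp (LRN R) (@LR R) _ (fun f => f i) set_val).
      exact: (@proj_continuous nat (fun=> @LR R : topologicalType) i).
    exact: (@initial_continuous _ _ set_val).
  exact: cvg_comp fi.
move=> f g fg; apply/funext => i; apply: val_inj; apply/funext => t.
exact: (fg (i, t)).
Qed.

(** A jointly continuous [F] is uniformly close to [F (_, x)] on any compact
    interval of times as soon as its second argument is close to [x]; the
    interval is chosen to contain the 1-neighbourhood of a given compact set,
    which is where [envelope_local] looks at the function. *)
Lemma continuous_envelope_family (X : topologicalType) (F : R * X -> R) :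
  (forall p, 0 <= F p) -> continuous F ->
  continuous (fun x => envelope (fun u => F (u, x)) : {family compact, R -> R}).
Proof.
move=> F0 cF x; apply/fam_cvgP => K cK P /uniform_nbhs[E [+ EP]].
rewrite -entourage_ballE => -[e /= e0 eE].
have [M [_ /(_ (M + 1))]] := compact_bounded cK.
rewrite ltrDl ltr01 => /(_ isT) KM.
pose J := `[- (M + 2), M + 2]%classic.
have : \forall y \near x, J `<=` [set u | `|F (u, x) - F (u, y)| < e / 2].
  have /compact_near_coveringP := @segment_compact R (- (M + 2)) (M + 2).
  apply => u _.
  (* [F (u, x)] serves as a pivot between [F (v, x)] and [F (v, y)]. *)
  have /cvgrPdist_lt/(_ (e / 4))[|[A B] [/= uA xB] AB] := cF (u, x).
    by rewrite divr_gt0.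
  exists (A, B) => //= -[v y] /= [Av By].
  have vx := AB (v, x) (conj Av (nbhs_singleton xB)).
  have vy := AB (v, y) (conj Av By).
  move: vx vy; rewrite /= !ltr_norml; lra.
apply: filterS => y Jy; apply: EP => t Kt; apply: eE => /=.
rewrite /ball /=.
apply: (@le_lt_trans _ _ (e / 2)); last by lra.
apply: envelope_local => // u ut; apply/ltW/Jy.
have := KM t Kt; move: ut; rewrite /J /= in_itv /= !ler_norml; lra.
Qed.

End LRN_topology.

(** * The coordinates of the embedding *)

Section orbit_envelope.
Context {R : realType} {X : metricType R} (varphi : R -> X -> X).
Context (Xflow : is_flow varphi).

Definition orbit_envelope (a x : X) : R -> R :=
  envelope (fun u => mdist a (varphi u x)).

Lemma orbit_envelope_LR a x : LR (orbit_envelope a x).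
Proof.
split=> [t|s t]; first by apply: envelope_ge0_le1 => u; exact: mdist_ge0.
by apply: envelope_lipschitz => u; exact: mdist_ge0.
Qed.

Lemma orbit_envelope_equivariant a x s t :
  orbit_envelope a (varphi s x) t = orbit_envelope a x (t + s).
Proof.
rewrite /orbit_envelope -envelope_shift; congr (envelope _ t).
by apply/funext => u; rewrite (flowD Xflow).
Qed.

Lemma orbit_envelope_continuous a :
  continuous (orbit_envelope a : X -> {family compact, R -> R}).
Proof.
apply: (@continuous_envelope_family R X (fun p => mdist a (varphi p.1 p.2))).
  by move=> p; exact: mdist_ge0.
move=> p; apply: continuous_comp; first exact: (flow_continuous Xflow).
exact: mdist_continuous.
Qed.

(** A small value of the envelope of the orbit of [y] at time 0 gives a time [u]
    such that both [|u|] and the distance from [a i] to [varphi u y] are small;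
    by continuity of the orbit at time 0, [y] is then close to [a i]. *)
Lemma orbit_envelope_separates (a : nat -> X) (x y : X) :
  (forall e : R, 0 < e -> exists i, mdist (a i) x < e) ->
  (forall i, orbit_envelope (a i) x 0 = orbit_envelope (a i) y 0) -> x = y.
Proof.
move=> ax xy; apply: mdist_positivity; apply/eqP; rewrite eq_le mdist_ge0 andbT.
apply/ler_addgt0Pl => e e0; rewrite addr0.
have yc : (fun s => varphi s y) @ (0 : R) --> y.
  rewrite -[X in _ --> X]/(id y) -(flow0 Xflow).
  have h := @flow_continuous _ _ _ Xflow (0, y).
  apply: (cvg_comp (fun s => (s, y)) _ _ h).
  exact: (cvg_pair cvg_id (cvg_cst y)).
have e20 : 0 < e / 2 by rewrite divr_gt0.
have /nbhs_ballP[d /= d0 dP] := yc _ (nbhsx_ballx y _ e20).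
(* The bound by 1 escapes the truncation of the envelope, the bound by [d] makes
   [varphi u y] close to [y], and [e / 4] bounds the distances from [a i] to
   both [x] and [varphi u y]. *)
pose c := Num.min 1 (Num.min d (e / 4)).
have c0 : 0 < c by rewrite !lt_min ltr01 d0 divr_gt0.
have /and3P[c1 cd ce] : [&& c <= 1, c <= d & c <= e / 4].
  by rewrite -!le_min.
have [i aix] := ax c c0.
have Ex : orbit_envelope (a i) x 0 < c.
  apply: le_lt_trans (envelope_le _ 0 0 _) _.
    by move=> u; exact: mdist_ge0.
  by rewrite (flow0 Xflow) subrr normr0 addr0 gt_min aix orbT.
rewrite xy in Ex.
have [|u] := envelope_ltP _ _ _ _ c1 Ex; first by move=> u; exact: mdist_ge0.
rewrite subr0 => au.
have := mdist_ge0 (a i) (varphi u y); have := normr_ge0 u => u0 m0.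
have yu : mdist y (varphi u y) < e / 2.
  have : ball y (e / 2) (varphi u y).
    by apply: dP; rewrite /ball /= sub0r normrN; lra.
  by rewrite ballEmdist.
have := metric_triangle x (a i) y; have := metric_triangle (a i) (varphi u y) y.
rewrite (metric_sym x (a i)) (metric_sym (varphi u y) y); lra.
Qed.

End orbit_envelope.

Theorem theorem1p2 (R : realType) (X : metricType R) (varphi : R -> X -> X)
    (Xflow : is_flow varphi) :
  exists phi : X -> LRN R,
    homeomorphism_onto_image phi /\
    forall (x : X) (t : R), phi (varphi t x) = translation t (phi x).
Proof.
(* The empty space has no sequence of points; there the empty map works. *)
have [[x0 _]|X0] := pselect (exists x : X, True); last first.
  have X0' (x : X) : False by apply: X0; exists x.
  exists (fun x => False_rect _ (X0' x)); split=> [|x]; last by case: (X0' x).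
  apply: compact_embedding => [|||x]; [exact: flow_compact Xflow| | |].
  - exact: LRN_hausdorff.
  - by move=> x; case: (X0' x).
  - by case: (X0' x).
have [a aP] := compact_dense_sequence x0 (flow_compact Xflow).
pose phi x : LRN R := fun i =>
  SigSub (mem_set (orbit_envelope_LR varphi (a i) x)) : @LR R.
exists phi; split=> [|x t]; last first.
  apply/funext => i; apply: val_inj; apply/funext => s.
  exact: orbit_envelope_equivariant.
apply: compact_embedding; [exact: flow_compact Xflow|exact: LRN_hausdorff| |].
  move=> x; apply/cvg_sup => i.
  have coord : continuous (fun x => phi x i).
    by apply: continuous_comp_initial; exact: orbit_envelope_continuous.
  apply: (@continuous_comp_initial _ _ _ (fun f : LRN R => f i)).
  exact: coord.
move=> x y xy; apply: (orbit_envelope_separates _ Xflow _ _ _ (aP x)) => i.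
by have /(congr1 (fun f : LRN R => (set_val (f i) : R -> R) 0)) := xy.
Qed.
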